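(* Let $(\mathcal{A}_1,\mu^1,\nu^1)$ and $(\mathcal{A}_2,\mu^2,\nu^2)$ be two Novikov-Poisson algebras, where $\nu^i$ denotes the commutative associative product and $\mu^i$ the Novikov product. Let $\alpha$ and $\beta$ be algebra homomorphisms of $(\mathcal{A}_1,\mu^1,\nu^1)$ and $(\mathcal{A}_2,\mu^2,\nu^2)$ respectively, and put $\mu^1_\alpha=\alpha\circ\mu^1$, $\nu^1_\alpha=\alpha\circ\nu^1$, $\mu^2_\beta=\beta\circ\mu^2$, $\nu^2_\beta=\beta\circ\nu^2$. Define bilinear operations on $\mathcal{A}_1\otimes\mathcal{A}_2$ by $$(\nu^1_\alpha\otimes\nu^2_\beta)(x_1\otimes x_2,y_1\otimes y_2)=\nu^1_\alpha(x_1,y_1)\otimes\nu^2_\beta(x_2,y_2),$$ $$(\mu^1_\alpha\otimes\mu^2_\beta)(x_1\otimes x_2,y_1\otimes y_2)=\mu^1_\alpha(x_1,y_1)\otimes\nu^2_\beta(x_2,y_2)+\nu^1_\alpha(x_1,y_1)\otimes\mu^2_\beta(x_2,y_2),$$ for $x_1,y_1\in\mathcal{A}_1$, $x_2,y_2\in\mathcal{A}_2$, and the linear map $(\alpha\otimes\beta)(x\otimes y)=\alpha(x)\otimes\beta(y)$. Then $(\mathcal{A}_1\otimes\mathcal{A}_2,\mu^1_\alpha\otimes\mu^2_\beta,\nu^1_\alpha\otimes\nu^2_\beta,\alpha\otimes\beta)$ is a Hom-Novikov-Poisson algebra (with $\mu^1_\alpha\otimes\mu^2_\beta$ the Hom-Novikov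 product and $\nu^1_\alpha\otimes\nu^2_\beta$ the commutative Hom-associative product).
   Context: All vector spaces and tensor products are over a field $\mathbb{F}$ of characteristic zero. A Novikov algebra $(\mathcal{A},\ast)$ is a vector space with a bilinear product satisfying $(x\ast y)\ast z=(x\ast z)\ast y$ and $(x\ast y)\ast z-x\ast(y\ast z)=(y\ast x)\ast z-y\ast(x\ast z)$ for all $x,y,z$. A Novikov-Poisson algebra is a vector space $\mathcal{A}$ with two bilinear operations $\cdot$ and $\ast$ such that $(\mathcal{A},\cdot)$ is a commutative associative algebra, $(\mathcal{A},\ast)$ is a Novikov algebra, and for all $x,y,z$: $(x\cdot y)\ast z=x\cdot(y\ast z)$ and $(x\ast y)\cdot z-x\ast(y\cdot z)=(y\ast x)\cdot z-y\ast(x\cdot z)$. An algebra homomorphism (endomorphism) of it is a linear map preserving both operations. A Hom-Novikov algebra $(\mathcal{A},\ast,\alpha)$ is a vector space with a bilinear product $\ast$ and a linear map $\alpha$ satisfying $\alpha(x\ast y)=\alpha(x)\ast\alpha(y)$, $(x\ast y)\ast\alpha(z)=(x\ast z)\ast\alpha(y)$ and $(x\ast y)\ast\alpha(z)-\alpha(x)\ast(y\ast z)=(y\ast x)\ast\alpha(z)-\alpha(y)\ast(x\ast z)$. A commutative Hom-associative algebra $(\mathcal{A},\cdot,\alpha)$ is a vector space with a commutative bilinear product $\cdot$ and a linear map $\alpha$ with $\alpha(x)\cdot(y\cdot z)=(x\cdot y)\cdot\alpha(z)$. A Hom-Novikov-Poisson algebra consists of a vector space $\mathcal{A}$, bilinear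 operations $\cdot$ and $\ast$, and an algebra homomorphism $\alpha$ of $\mathcal{A}$ (linear, preserving both operations) such that $(\mathcal{A},\ast,\alpha)$ is a Hom-Novikov algebra, $(\mathcal{A},\cdot,\alpha)$ is a commutative Hom-associative algebra, and for all $x,y,z$: $(x\cdot y)\ast\alpha(z)=\alpha(x)\cdot(y\ast z)$ and $(x\ast y)\cdot\alpha(z)-\alpha(x)\ast(y\cdot z)=(y\ast x)\cdot\alpha(z)-\alpha(y)\ast(x\cdot z)$. *)

(* Defs.v *)
From HB Require Import structures.
From mathcomp Require Import all_boot all_algebra.
From mathcomp Require Import boolp.
From mathcomp Require Import ring_quotient freeg.

Set Implicit Arguments.
Unset Strict Implicit.
Unset Printing Implicit Defensive.

Import GRing.Theory.
Local Open Scope ring_scope.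
Local Open Scope quotient_scope.

(** * Tensor product of two (possibly infinite-dimensional) vector spaces

    [tensor A B] is the free vector space on [A * B] modulo the subspace
    spanned by the bilinearity relations. *)

Section Tensor.
Variables (F : fieldType) (A B : lmodType F).

Local Notation free := {freeg (A * B)%type / F}.
Local Notation "[ a , b ]" := (<< (a, b) >> : free).

Inductive tensor_rel : free -> Prop :=
| tensor_rel0 : tensor_rel 0
| tensor_relP c u v : tensor_rel u -> tensor_rel v -> tensor_rel (c *: u + v)
| tensor_rell c a a' b : tensor_rel ([c *: a + a', b] - (c *: [a, b] + [a', b]))
| tensor_relr c a b b' : tensor_rel ([a, c *: b + b'] - (c *: [a, b] + [a, b'])).

Definition tensor_null (u : free) : bool := `[< tensor_rel u >].

Lemma tensor_nullP u : reflect (tensor_rel u) (u \in tensor_null).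
Proof. exact: asboolP. Qed.

Fact tensor_null_zmod_closed : zmod_closed tensor_null.
Proof.
split=> [|u v /tensor_nullP ru /tensor_nullP rv]; apply/tensor_nullP.
  exact: tensor_rel0.
by rewrite addrC -scaleN1r; apply: tensor_relP.
Qed.

HB.instance Definition _ :=
  GRing.isZmodClosed.Build free tensor_null tensor_null_zmod_closed.

Definition tensor_nullZ := GRing.ZmodClosed.clone free tensor_null _.

Definition tensor : Type := {ideal_quot tensor_nullZ}.

HB.instance Definition _ := GRing.Zmodule.on tensor.
HB.instance Definition _ := Quotient.on tensor.

Definition tensor_pi (u : free) : tensor := \pi_{ideal_quot tensor_nullZ} u.

Lemma tensor_piP u v : tensor_pi u = tensor_pi v <-> tensor_rel (u - v).
Proof.
split=> [/eqP | ruv].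
  by rewrite /tensor_pi -Quotient.idealrBE => /tensor_nullP.
apply/eqP; rewrite /tensor_pi -Quotient.idealrBE; exact/tensor_nullP.
Qed.

Lemma tensor_piD u v : tensor_pi (u + v) = tensor_pi u + tensor_pi v.
Proof. exact: (raddfD (\pi_{ideal_quot tensor_nullZ})). Qed.

Lemma tensor_reprK (t : tensor) : tensor_pi (repr t) = t.
Proof. exact: reprK. Qed.

Definition tensor_scale (c : F) (t : tensor) : tensor :=
  tensor_pi (c *: repr t).

Lemma tensor_piZ c u : tensor_pi (c *: u) = tensor_scale c (tensor_pi u).
Proof.
apply/tensor_piP; rewrite -scalerBr -[_ *: _]addr0.
apply: tensor_relP; last exact: tensor_rel0.
by apply/tensor_piP; rewrite tensor_reprK.
Qed.

Fact tensor_scaleA c d t :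
  tensor_scale c (tensor_scale d t) = tensor_scale (c * d) t.
Proof. by rewrite -(tensor_reprK t) -!tensor_piZ scalerA. Qed.

Fact tensor_scale1 : left_id 1 tensor_scale.
Proof. by move=> t; rewrite -(tensor_reprK t) -!tensor_piZ scale1r. Qed.

Fact tensor_scaleDr : right_distributive tensor_scale +%R.
Proof.
move=> c s t; rewrite -(tensor_reprK s) -(tensor_reprK t).
by rewrite -tensor_piD -!tensor_piZ scalerDr tensor_piD.
Qed.

Fact tensor_scaleDl t : {morph tensor_scale^~ t : c d / c + d}.
Proof.
by move=> c d; rewrite -(tensor_reprK t) -!tensor_piZ scalerDl tensor_piD.
Qed.

HB.instance Definition _ := GRing.Zmodule_isLmodule.Build F tensor
  tensor_scaleA tensor_scale1 tensor_scaleDr tensor_scaleDl.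

Fact tensor_pi_is_linear : linear tensor_pi.
Proof. by move=> c u v; rewrite tensor_piD tensor_piZ. Qed.

HB.instance Definition _ :=
  GRing.isLinear.Build F free tensor *:%R tensor_pi tensor_pi_is_linear.

Definition pure (a : A) (b : B) : tensor := tensor_pi [a, b].

Fact pure_is_bilinear : bilinear_for *:%R *:%R pure.
Proof.
split=> [b c a a' | a c b b'] /=.
  rewrite /pure -linearP; apply/tensor_piP; exact: tensor_rell.
rewrite /pure -linearP; apply/tensor_piP; exact: tensor_relr.
Qed.

HB.instance Definition _ :=
  bilinear_isBilinear.Build F A B tensor *:%R *:%R pure pure_is_bilinear.

Lemma tensor_ind (P : tensor -> Prop) :
  P 0 -> (forall a b, P (pure a b)) ->
  (forall c s t, P s -> P t -> P (c *: s + t)) -> forall t, P t.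
Proof.
move=> P0 Pp PD t; rewrite -(tensor_reprK t); move: (repr t) => u.
rewrite -(freeg_sumE u); elim: (dom u) => [|[a b] s IHs].
  by rewrite big_nil linear0.
rewrite big_cons.
set k := coeff _ _.
have -> : << k *g (a, b) >> = k *: [a, b].
  by apply/eqP/freeg_eqP => x; rewrite coeffZ !coeffU mul1r.
by rewrite linearP; apply: PD IHs; apply: Pp.
Qed.

End Tensor.

(** * Universal property *)

Section TensorLift.
Variables (F : fieldType) (A B W : lmodType F) (f : {bilinear A -> B -> W}).

Local Notation free := {freeg (A * B)%type / F}.

Let flift (u : free) : W := fglift (fun p => f p.1 p.2) u.

Let fliftD : {morph flift : u v / u + v}.
Proof.
move=> u v; have fB := lift_is_additive (fun p => f p.1 p.2 : W).
have f0 : flift 0 = 0 by rewrite -[0](subrr (0 : free)) /flift fB subrr.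
by rewrite -[v in LHS]opprK -[- v]sub0r /flift !fB -/(flift 0) f0 sub0r opprK.
Qed.

Let fliftU k p : flift << k *g p >> = k *: f p.1 p.2.
Proof. exact: liftU. Qed.

Let fliftZ c : {morph flift : u / c *: u}.
Proof.
have f0 : flift 0 = 0 by apply: (addrI (flift 0)); rewrite -fliftD !addr0.
move=> u; rewrite -(freeg_sumE u); elim: (dom u) => [|p s IHs].
  by rewrite big_nil scaler0 f0 scaler0.
rewrite big_cons scalerDr !fliftD IHs scalerDr; congr (_ + _).
set k := coeff _ _.
have -> : c *: << k *g p >> = << (c * k) *g p >> :> free.
  by apply/eqP/freeg_eqP => x; rewrite coeffZ !coeffU mulrA.
by rewrite !fliftU scalerA.
Qed.

Let flift_rel u : tensor_rel u -> flift u = 0.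
Proof.
have fN v : flift (- v) = - flift v by rewrite -[in LHS]scaleN1r fliftZ scaleN1r.
elim=> [|c {}u v _ u0 _ v0|c a a' b|c a b b'].
- by rewrite -(scale0r 0) fliftZ scale0r.
- by rewrite fliftD fliftZ u0 v0 scaler0 addr0.
- by rewrite fliftD fN fliftD fliftZ !fliftU !scale1r /= linearPl subrr.
- by rewrite fliftD fN fliftD fliftZ !fliftU !scale1r /= linearPr subrr.
Qed.

Definition tensor_lift (t : tensor A B) : W :=
  fglift (fun p => f p.1 p.2) (repr t).

Let liftpi u : tensor_lift (tensor_pi u) = flift u.
Proof.
apply/eqP; rewrite -subr_eq0; apply/eqP.
rewrite -[tensor_lift _]/(flift _) -scaleN1r -fliftZ -fliftD scaleN1r.
by apply/flift_rel/tensor_piP; rewrite tensor_reprK.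
Qed.

Fact tensor_lift_is_linear : linear tensor_lift.
Proof.
move=> c s t; rewrite -(tensor_reprK s) -(tensor_reprK t) -linearP.
by rewrite !liftpi fliftD fliftZ.
Qed.

HB.instance Definition _ :=
  GRing.isLinear.Build F (tensor A B) W *:%R tensor_lift tensor_lift_is_linear.

Lemma tensor_liftE a b : tensor_lift (pure a b) = f a b.
Proof. by rewrite liftpi fliftU scale1r. Qed.

Lemma tensor_lift_uniq (g : {linear tensor A B -> W}) :
  (forall a b, g (pure a b) = f a b) -> g =1 tensor_lift.
Proof.
move=> gE; apply: tensor_ind => [|a b|c s t IHs IHt].
- by rewrite !linear0.
- by rewrite gE tensor_liftE.
- by rewrite !linearP IHs IHt.
Qed.

End TensorLift.

(** * Operations on tensor products *)

Section TensorMap.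
Variables (F : fieldType) (A B A' B' : lmodType F).
Variables (f : {linear A -> A'}) (g : {linear B -> B'}).

Definition pure_map (a : A) (b : B) : tensor A' B' := pure (f a) (g b).

Fact pure_map_is_bilinear : bilinear_for *:%R *:%R pure_map.
Proof.
by split=> [b c a a' | a c b b']; rewrite /pure_map linearP (linearPl, linearPr).
Qed.

HB.instance Definition _ := bilinear_isBilinear.Build F A B (tensor A' B')
  *:%R *:%R pure_map pure_map_is_bilinear.

Definition tensor_map : tensor A B -> tensor A' B' := tensor_lift pure_map.

HB.instance Definition _ := GRing.Linear.on tensor_map.

Lemma tensor_mapE a b : tensor_map (pure a b) = pure (f a) (g b).
Proof. exact: tensor_liftE. Qed.

End TensorMap.

(** [tensor_mul f g] is the bilinear operation characterised on pure tensors by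
    [tensor_mulE]; [tensor_novikov] below is characterised by
    [tensor_novikovE]. *)

Section TensorMul.
Variables (F : fieldType) (A B : lmodType F).
Variables (f : {bilinear A -> A -> A}) (g : {bilinear B -> B -> B}).

Definition pure_mulr (x : A) (y : B) : tensor A B -> tensor A B :=
  tensor_map (f x) (g y).

Definition pure_mul (t : tensor A B) (x : A) (y : B) : tensor A B :=
  pure_mulr x y t.

Fact pure_mul_linearl t y : linear (pure_mul t ^~ y).
Proof.
move=> c x x'; rewrite /pure_mul /pure_mulr.
elim/tensor_ind: t => [|a b|d s t IHs IHt].
- by rewrite !linear0 addr0.
- by rewrite !tensor_mapE /= !linearPl.
- rewrite ![tensor_map _ _ (_ + _)]linearP /= IHs IHt !scalerDr !scalerA -!addrA.
  by congr (_ + _); [rewrite mulrC | rewrite addrCA].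
Qed.

Fact pure_mul_linearr t x : linear (pure_mul t x).
Proof.
move=> c y y'; rewrite /pure_mul /pure_mulr.
elim/tensor_ind: t => [|a b|d s t IHs IHt].
- by rewrite !linear0 addr0.
- by rewrite !tensor_mapE /= linearPl linearPr.
- rewrite ![tensor_map _ _ (_ + _)]linearP /= IHs IHt !scalerDr !scalerA -!addrA.
  by congr (_ + _); [rewrite mulrC | rewrite addrCA].
Qed.

Fact pure_mul_is_bilinear t : bilinear_for *:%R *:%R (pure_mul t).
Proof. by split=> [y | x]; [apply: pure_mul_linearl | apply: pure_mul_linearr]. Qed.

HB.instance Definition _ t := bilinear_isBilinear.Build F A B (tensor A B)
  *:%R *:%R (pure_mul t) (pure_mul_is_bilinear t).

Definition tensor_mul (s t : tensor A B) : tensor A B :=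
  tensor_lift (pure_mul t) s.

Lemma tensor_mulE x1 x2 y1 y2 :
  tensor_mul (pure x1 x2) (pure y1 y2) = pure (f x1 y1) (g x2 y2).
Proof. by rewrite /tensor_mul tensor_liftE; apply: tensor_mapE. Qed.

Fact tensor_mul_linearr s : linear (tensor_mul s).
Proof.
move=> c t t'; rewrite /tensor_mul.
elim/tensor_ind: s => [|a b|d r s IHr IHs].
- by rewrite !linear0 addr0.
- by rewrite !tensor_liftE /= /pure_mul /pure_mulr linearP.
- rewrite ![tensor_lift _ (_ + _)]linearP /= IHr IHs !scalerDr !scalerA -!addrA.
  by congr (_ + _); [rewrite mulrC | rewrite addrCA].
Qed.

Fact tensor_mul_is_bilinear : bilinear_for *:%R *:%R tensor_mul.
Proof.
split=> [t c s s' | s]; first by rewrite /tensor_mul linearP.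
exact: tensor_mul_linearr.
Qed.

HB.instance Definition _ := bilinear_isBilinear.Build F
  (tensor A B) (tensor A B) (tensor A B) *:%R *:%R
  tensor_mul tensor_mul_is_bilinear.

End TensorMul.

Section BilinearOps.
Variables (F : fieldType) (A : lmodType F).

Definition twist (alpha : {linear A -> A}) (f : {bilinear A -> A -> A})
  (x y : A) : A := alpha (f x y).

Fact twist_is_bilinear alpha f : bilinear_for *:%R *:%R (twist alpha f).
Proof.
by split=> [y c x x' | x c y y']; rewrite /twist (linearPl, linearPr) linearP.
Qed.

HB.instance Definition _ alpha f := bilinear_isBilinear.Build F A A A
  *:%R *:%R (twist alpha f) (twist_is_bilinear alpha f).

Definition bilin_add (f g : {bilinear A -> A -> A}) (x y : A) : A :=
  f x y + g x y.

Fact bilin_add_linearl f g y : linear (bilin_add f g ^~ y).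
Proof. by move=> c x x'; rewrite /bilin_add !linearPl scalerDr addrACA. Qed.

Fact bilin_add_linearr f g x : linear (bilin_add f g x).
Proof. by move=> c y y'; rewrite /bilin_add !linearPr scalerDr addrACA. Qed.

Fact bilin_add_is_bilinear f g : bilinear_for *:%R *:%R (bilin_add f g).
Proof.
by split=> [y | x]; [apply: bilin_add_linearl | apply: bilin_add_linearr].
Qed.

HB.instance Definition _ f g := bilinear_isBilinear.Build F A A A
  *:%R *:%R (bilin_add f g) (bilin_add_is_bilinear f g).

End BilinearOps.

Section NovikovTensor.
Variables (F : fieldType) (A B : lmodType F).
Variables (mu1 nu1 : {bilinear A -> A -> A}) (mu2 nu2 : {bilinear B -> B -> B}).

Definition tensor_novikov : tensor A B -> tensor A B -> tensor A B :=
  bilin_add (tensor_mul mu1 nu2) (tensor_mul nu1 mu2).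

HB.instance Definition _ := Bilinear.on tensor_novikov.

Lemma tensor_novikovE x1 x2 y1 y2 :
  tensor_novikov (pure x1 x2) (pure y1 y2) =
  pure (mu1 x1 y1) (nu2 x2 y2) + pure (nu1 x1 y1) (mu2 x2 y2).
Proof. by rewrite /tensor_novikov /bilin_add /= !tensor_mulE. Qed.

End NovikovTensor.

(** * Novikov-Poisson and Hom-Novikov-Poisson algebras

    Throughout, [mu] is the (Hom-)Novikov product and [nu] the commutative
    (Hom-)associative one. *)

Section Algebras.
Variables (F : fieldType) (A : lmodType F).
Implicit Types (mu nu : {bilinear A -> A -> A}) (alpha : {linear A -> A}).

Record is_novikov mu : Prop := {
  novikov_right_comm : forall x y z, mu (mu x y) z = mu (mu x z) y;
  novikov_left_symm : forall x y z,
    mu (mu x y) z - mu x (mu y z) = mu (mu y x) z - mu y (mu x z)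
}.

Record is_comm_assoc nu : Prop := {
  comm_assoc_comm : forall x y, nu x y = nu y x;
  comm_assoc_assoc : forall x y z, nu x (nu y z) = nu (nu x y) z
}.

Record is_novikov_poisson mu nu : Prop := {
  np_comm_assoc : is_comm_assoc nu;
  np_novikov : is_novikov mu;
  np_compat : forall x y z, mu (nu x y) z = nu x (mu y z);
  np_left_symm : forall x y z,
    nu (mu x y) z - mu x (nu y z) = nu (mu y x) z - mu y (nu x z)
}.

Record is_endomorphism mu nu alpha : Prop := {
  endo_mu : forall x y, alpha (mu x y) = mu (alpha x) (alpha y);
  endo_nu : forall x y, alpha (nu x y) = nu (alpha x) (alpha y)
}.

Record is_hom_novikov mu alpha : Prop := {
  hom_novikov_mult : forall x y, alpha (mu x y) = mu (alpha x) (alpha y);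
  hom_novikov_right_comm : forall x y z,
    mu (mu x y) (alpha z) = mu (mu x z) (alpha y);
  hom_novikov_left_symm : forall x y z,
    mu (mu x y) (alpha z) - mu (alpha x) (mu y z) =
    mu (mu y x) (alpha z) - mu (alpha y) (mu x z)
}.

Record is_comm_hom_assoc nu alpha : Prop := {
  comm_hom_assoc_comm : forall x y, nu x y = nu y x;
  comm_hom_assoc_assoc : forall x y z,
    nu (alpha x) (nu y z) = nu (nu x y) (alpha z)
}.

Record is_hom_novikov_poisson mu nu alpha : Prop := {
  hnp_endo : is_endomorphism mu nu alpha;
  hnp_hom_novikov : is_hom_novikov mu alpha;
  hnp_comm_hom_assoc : is_comm_hom_assoc nu alpha;
  hnp_compat : forall x y z, mu (nu x y) (alpha z) = nu (alpha x) (mu y z);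
  hnp_left_symm : forall x y z,
    nu (mu x y) (alpha z) - mu (alpha x) (nu y z) =
    nu (mu y x) (alpha z) - mu (alpha y) (nu x z)
}.

End Algebras.

(* Main.v *)
Require Import Defs.
From HB Require Import structures.
From mathcomp Require Import all_boot all_algebra.

Set Implicit Arguments.
Unset Strict Implicit.
Unset Printing Implicit Defensive.

Import GRing.Theory.
Local Open Scope ring_scope.

(** The twisted tensor product is assembled from two independent facts.

    First, for untwisted Novikov-Poisson algebras the operations
    nu = nu1 (x) nu2 and mu = mu1 (x) nu2 + nu1 (x) mu2 make the tensor product
    a Novikov-Poisson algebra ([tensor_novikov_poisson]).  All the axioms are
    trilinear, so it suffices to check them on pure tensors
    ([tensor_trilinear_eq]).  In the two Novikov axioms the terms sort
    into those where both uses of mu act in the same factor, which are handled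
    by the Novikov axioms of that factor, and mixed terms, where each factor
    only sees expressions with one Novikov product and one commutative
    product.  The two compatibility
    axioms are exactly what makes the mixed terms have the required symmetry.

    Secondly, composing both products of a Novikov-Poisson algebra with an
    endomorphism yields a Hom-Novikov-Poisson algebra
    ([twist_hom_novikov_poisson]): after pushing the endomorphism to the
    outside, each three-variable Hom-axiom is the square of the endomorphism
    applied to the corresponding ordinary axiom.

    These combine because tensoring the twisted products is the same as
    twisting the tensored products by alpha (x) beta
    ([tensor_mul_twist], [tensor_novikov_twist]), and alpha (x) beta is an
    endomorphism of the tensor product ([tensor_map_endomorphism]). *)

(** * Trilinear maps on tensor products *)

Section Trilinear.
Variables (F : fieldType) (U V : lmodType F).

Definition trilinear (T : U -> U -> U -> V) : Prop :=
  [/\ forall y z, linear (fun x => T x y z),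
      forall x z, linear (fun y => T x y z)
    & forall x y, linear (fun z => T x y z)].

Lemma trilinearB (S T : U -> U -> U -> V) :
  trilinear S -> trilinear T -> trilinear (fun x y z => S x y z - T x y z).
Proof.
move=> [S1 S2 S3] [T1 T2 T3].
have linB (f g : U -> V) : linear f -> linear g -> linear (fun x => f x - g x).
  by move=> fP gP c u v; rewrite fP gP scalerBr opprD addrACA.
by split=> *; apply: linB.
Qed.

Lemma trilinear_swap12 (T : U -> U -> U -> V) :
  trilinear T -> trilinear (fun x y z => T y x z).
Proof. by move=> [T1 T2 T3]; split. Qed.

Lemma trilinear_swap23 (T : U -> U -> U -> V) :
  trilinear T -> trilinear (fun x y z => T x z y).
Proof. by move=> [T1 T2 T3]; split. Qed.

End Trilinear.

Section Nested.
Variables (F : fieldType) (U : lmodType F) (f g : {bilinear U -> U -> U}).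

Lemma trilinear_nestl : trilinear (fun x y z => f (g x y) z).
Proof.
split=> [y z|x z|x y] c u v; first by rewrite !linearPl.
- by rewrite linearPr linearPl.
- by rewrite linearPr.
Qed.

Lemma trilinear_nestr : trilinear (fun x y z => f x (g y z)).
Proof.
split=> [y z|x z|x y] c u v; first by rewrite linearPl.
- by rewrite linearPl linearPr.
- by rewrite !linearPr.
Qed.

End Nested.

Section Extensionality.
Variables (F : fieldType) (A B W : lmodType F).
Local Notation AB := (tensor A B).

Lemma tensor_linear_eq (f g : AB -> W) : linear f -> linear g ->
  (forall a b, f (pure a b) = g (pure a b)) -> f =1 g.
Proof.
have lin0 (h : AB -> W) : linear h -> h 0 = 0.
  by move=> hP; have := hP (-1) 0 0; rewrite scaler0 addr0 !scaleN1r addNr.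
move=> fP gP fg; apply: tensor_ind => [|//|c s t fgs fgt].
- by rewrite !lin0.
- by rewrite fP gP fgs fgt.
Qed.

Lemma tensor_trilinear_eq (S T : AB -> AB -> AB -> W) :
    trilinear S -> trilinear T ->
    (forall x1 x2 y1 y2 z1 z2,
      S (pure x1 x2) (pure y1 y2) (pure z1 z2) =
      T (pure x1 x2) (pure y1 y2) (pure z1 z2)) ->
  forall x y z, S x y z = T x y z.
Proof.
move=> [S1 S2 S3] [T1 T2 T3] ST x y z.
apply: (tensor_linear_eq (S1 y z) (T1 y z)) => x1 x2.
apply: (tensor_linear_eq (S2 _ z) (T2 _ z)) => y1 y2.
apply: (tensor_linear_eq (S3 _ _) (T3 _ _)) => z1 z2.
exact: ST.
Qed.

Lemma tensor_bilinear_eq (f g : AB -> AB -> W) :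
    (forall t, linear (f ^~ t)) -> (forall s, linear (f s)) ->
    (forall t, linear (g ^~ t)) -> (forall s, linear (g s)) ->
    (forall x1 x2 y1 y2,
      f (pure x1 x2) (pure y1 y2) = g (pure x1 x2) (pure y1 y2)) ->
  forall s t, f s t = g s t.
Proof.
move=> fl fr gl gr fg s t.
apply: (tensor_linear_eq (fl t) (gl t)) => x1 x2.
by apply: (tensor_linear_eq (fr _) (gr _)) => y1 y2.
Qed.

End Extensionality.

(** * The tensor product of Novikov-Poisson algebras *)

Section NovikovPoissonTensor.
Variables (F : fieldType) (A1 A2 : lmodType F).
Variables (mu1 nu1 : {bilinear A1 -> A1 -> A1}).
Variables (mu2 nu2 : {bilinear A2 -> A2 -> A2}).
Hypotheses (NP1 : is_novikov_poisson mu1 nu1).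
Hypotheses (NP2 : is_novikov_poisson mu2 nu2).

Local Notation mu := (tensor_novikov mu1 nu1 mu2 nu2).
Local Notation nu := (tensor_mul nu1 nu2).

Lemma tensor_comm_assoc : is_comm_assoc nu.
Proof.
have [[C1 As1] _ _ _] := NP1; have [[C2 As2] _ _ _] := NP2.
split.
  apply: (@tensor_bilinear_eq _ _ _ _ nu (fun s t => nu t s)) => [t|s|t|s|x1 x2 y1 y2].

  - by move=> c u v; rewrite linearPl.
  - by move=> c u v; rewrite linearPr.
  - by move=> c u v; rewrite linearPr.
  - by move=> c u v; rewrite linearPl.
  - by rewrite /= !tensor_mulE C1 C2.
apply: tensor_trilinear_eq => [||*].
- exact: trilinear_nestr.
- exact: trilinear_nestl.
- by rewrite /= !tensor_mulE As1 As2.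
Qed.

(** The mixed terms of the associator pair up across the two nested products:
    the compatibility axiom identifies the second components of a pair (or the
    first ones), so that each pair is a pure tensor of an expression symmetric
    in its first two arguments and a mixed associator of one factor. *)
Lemma tensor_novikov_associator x1 x2 y1 y2 z1 z2 :
  let x := pure x1 x2 in let y := pure y1 y2 in let z := pure z1 z2 in
  mu (mu x y) z - mu x (mu y z) =
    pure (mu1 (mu1 x1 y1) z1 - mu1 x1 (mu1 y1 z1)) (nu2 (nu2 x2 y2) z2)
  + pure (nu1 (mu1 x1 y1) z1 - mu1 x1 (nu1 y1 z1)) (mu2 (nu2 x2 y2) z2)
  + pure (mu1 (nu1 x1 y1) z1) (nu2 (mu2 x2 y2) z2 - mu2 x2 (nu2 y2 z2))
  + pure (nu1 (nu1 x1 y1) z1) (mu2 (mu2 x2 y2) z2 - mu2 x2 (mu2 y2 z2)).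
Proof.
have [[_ As1] _ M1 _] := NP1; have [[_ As2] _ M2 _] := NP2.
rewrite /= !tensor_novikovE linearDl linearDr /= !tensor_novikovE.
rewrite !linearBl !linearBr /= !(M1, M2, As1, As2) !opprD.
(* With the terms numbered from left to right, (2, 7) and (3, 6) are the mixed
   pairs, while (1, 5) and (4, 8) come from the associators of the factors. *)
by rewrite [LHS](AC ((2*2)*(2*2)) (1*5*(2*7)*(3*6)*(4*8))).
Qed.

Lemma tensor_is_novikov : is_novikov mu.
Proof.
have [[C1 As1] [R1 L1] M1 S1] := NP1; have [[C2 As2] [R2 L2] M2 S2] := NP2.
have nuCA1 x y z : nu1 (nu1 x y) z = nu1 (nu1 x z) y by rewrite -!As1 (C1 y).
have nuCA2 x y z : nu2 (nu2 x y) z = nu2 (nu2 x z) y by rewrite -!As2 (C2 y).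
split.
  apply: tensor_trilinear_eq => [||x1 x2 y1 y2 z1 z2].
  - exact: trilinear_nestl.
  - exact/trilinear_swap23/trilinear_nestl.
  (* Exchanging y and z swaps the two mixed terms: writing * for the Novikov
     product and juxtaposition for the commutative one, each factor satisfies
     (x * y) z = z (x * y) = (z x) * y = (x z) * y. *)
  rewrite /= !tensor_novikovE !linearDl /= !tensor_novikovE.
  have mixed1 x y z : nu1 (mu1 x y) z = mu1 (nu1 x z) y by rewrite C1 -M1 C1.
  have mixed2 x y z : nu2 (mu2 x y) z = mu2 (nu2 x z) y by rewrite C2 -M2 C2.
  rewrite !mixed1 !mixed2 (R1 x1 y1) (R2 x2 y2) (nuCA1 x1 y1) (nuCA2 x2 y2).
  by rewrite [LHS](AC (2*2) (1*3*(2*4))).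
have comm_nest := trilinearB (trilinear_nestl mu mu) (trilinear_nestr mu mu).
apply: (tensor_trilinear_eq comm_nest (trilinear_swap12 comm_nest)).
move=> x1 x2 y1 y2 z1 z2.
by rewrite /= !tensor_novikov_associator L1 L2 S1 S2 (C1 x1 y1) (C2 x2 y2).
Qed.

Lemma tensor_novikov_poisson : is_novikov_poisson mu nu.
Proof.
have [[C1 As1] _ M1 S1] := NP1; have [[C2 As2] _ M2 S2] := NP2.
split; [exact: tensor_comm_assoc | exact: tensor_is_novikov | |].
  apply: tensor_trilinear_eq => [||x1 x2 y1 y2 z1 z2].
  - exact: trilinear_nestl.
  - exact: trilinear_nestr.
  rewrite /= tensor_novikovE tensor_mulE linearDr /= !tensor_mulE.
  by rewrite tensor_novikovE M1 M2 As1 As2.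
have assoc_nest := trilinearB (trilinear_nestl nu mu) (trilinear_nestr mu nu).
apply: (tensor_trilinear_eq assoc_nest (trilinear_swap12 assoc_nest)).
move=> x1 x2 y1 y2 z1 z2.
have assocE a1 a2 b1 b2 :
    nu (mu (pure a1 a2) (pure b1 b2)) (pure z1 z2)
      - mu (pure a1 a2) (nu (pure b1 b2) (pure z1 z2)) =
    pure (nu1 (mu1 a1 b1) z1 - mu1 a1 (nu1 b1 z1)) (nu2 (nu2 a2 b2) z2)
      + pure (nu1 (nu1 a1 b1) z1) (nu2 (mu2 a2 b2) z2 - mu2 a2 (nu2 b2 z2)).
  rewrite tensor_mulE !tensor_novikovE linearDl /= !tensor_mulE.
  by rewrite linearBl linearBr /= !As1 !As2 opprD addrACA.
by rewrite /= !assocE S1 S2 (C1 x1 y1) (C2 x2 y2).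
Qed.

End NovikovPoissonTensor.

(** * Twisting by an endomorphism *)

Section Twist.
Variables (F : fieldType) (A : lmodType F).
Variables (mu nu : {bilinear A -> A -> A}) (alpha : {linear A -> A}).

(** Yau's twisting principle. *)
Lemma twist_hom_novikov_poisson :
  is_novikov_poisson mu nu -> is_endomorphism mu nu alpha ->
  is_hom_novikov_poisson (twist alpha mu) (twist alpha nu) alpha.
Proof.
move=> [[C As] [R L] M S] [mumu nunu].
split; [split | split | split | |] => x y *; rewrite /= /twist.
- by rewrite mumu.
- by rewrite nunu.
- by rewrite mumu.
- by rewrite -!mumu R.
- by rewrite -!mumu -!linearB L.
- by rewrite C.
- by rewrite -!nunu As.
- by rewrite -mumu -nunu M.
- by rewrite -!(mumu, nunu) -!linearB S.
Qed.

End Twist.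

(** Tensoring twisted products and twisting tensored ones give maps that agree
    on all arguments without being convertible, hence this transport. *)
Lemma eq_hom_novikov_poisson (F : fieldType) (A : lmodType F)
    (mu mu' nu nu' : {bilinear A -> A -> A}) (alpha : {linear A -> A}) :
    mu =2 mu' -> nu =2 nu' ->
  is_hom_novikov_poisson mu nu alpha -> is_hom_novikov_poisson mu' nu' alpha.
Proof.
move=> muE nuE [[mumu nunu] [_ R L] [C As] M S].
split; [split | split | split | |] => *; rewrite -!(muE, nuE) //.
Qed.

Section TensorTwist.
Variables (F : fieldType) (A1 A2 : lmodType F).
Variables (alpha : {linear A1 -> A1}) (beta : {linear A2 -> A2}).

Lemma tensor_mul_twist
    (f : {bilinear A1 -> A1 -> A1}) (g : {bilinear A2 -> A2 -> A2}) s t :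
  tensor_mul (twist alpha f) (twist beta g) s t =
  twist (tensor_map alpha beta) (tensor_mul f g) s t.
Proof.
apply: tensor_bilinear_eq s t => [t|s|t|s|x1 x2 y1 y2].
- by move=> c u v; rewrite linearPl.
- by move=> c u v; rewrite linearPr.
- by move=> c u v; rewrite linearPl.
- by move=> c u v; rewrite linearPr.
- by rewrite /twist /= !tensor_mulE tensor_mapE.
Qed.

Variables (mu1 nu1 : {bilinear A1 -> A1 -> A1}).
Variables (mu2 nu2 : {bilinear A2 -> A2 -> A2}).

Lemma tensor_novikov_twist s t :
  tensor_novikov (twist alpha mu1) (twist alpha nu1)
                 (twist beta mu2) (twist beta nu2) s t =
  twist (tensor_map alpha beta) (tensor_novikov mu1 nu1 mu2 nu2) s t.
Proof.
by rewrite /tensor_novikov /bilin_add /= !tensor_mul_twist /twist -linearD.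
Qed.

Lemma tensor_map_endomorphism :
  is_endomorphism mu1 nu1 alpha -> is_endomorphism mu2 nu2 beta ->
  is_endomorphism (tensor_novikov mu1 nu1 mu2 nu2) (tensor_mul nu1 nu2)
                  (tensor_map alpha beta).
Proof.
have tensor_endo (f : {bilinear A1 -> A1 -> A1}) (g : {bilinear A2 -> A2 -> A2}) :
    {morph alpha : x y / f x y} -> {morph beta : x y / g x y} ->
  {morph tensor_map alpha beta : s t / tensor_mul f g s t}.
  move=> fM gM s t.
  pose T : {linear _ -> _} := tensor_map alpha beta.
  apply: (tensor_bilinear_eq (f := fun s t => T (tensor_mul f g s t))
    (g := fun s t => tensor_mul f g (T s) (T t))) s t => [t|s|t|s|x1 x2 y1 y2].
  - by move=> c u v; rewrite linearPl linearP.
  - by move=> c u v; rewrite linearPr linearP.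
  - by move=> c u v; rewrite linearP linearPl.
  - by move=> c u v; rewrite linearP linearPr.
  - by rewrite /T /= tensor_mulE !tensor_mapE tensor_mulE fM gM.
move=> [mumu1 nunu1] [mumu2 nunu2]; split=> s t; last exact: tensor_endo.
by rewrite /= /tensor_novikov /bilin_add /= linearD /= !tensor_endo.
Qed.

End TensorTwist.

Theorem theorem5p2 (F : fieldType) (charF0 : [pchar F] =i pred0)
    (A1 A2 : lmodType F)
    (mu1 nu1 : {bilinear A1 -> A1 -> A1}) (mu2 nu2 : {bilinear A2 -> A2 -> A2})
    (NP1 : is_novikov_poisson mu1 nu1) (NP2 : is_novikov_poisson mu2 nu2)
    (alpha : {linear A1 -> A1}) (beta : {linear A2 -> A2})
    (alphaM : is_endomorphism mu1 nu1 alpha)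
    (betaM : is_endomorphism mu2 nu2 beta) :
  is_hom_novikov_poisson
    (tensor_novikov (twist alpha mu1) (twist alpha nu1)
                    (twist beta mu2) (twist beta nu2))
    (tensor_mul (twist alpha nu1) (twist beta nu2))
    (tensor_map alpha beta).
Proof.
have NP := tensor_novikov_poisson NP1 NP2.
have tensorM := tensor_map_endomorphism alphaM betaM.
apply: eq_hom_novikov_poisson (twist_hom_novikov_poisson NP tensorM) => s t.
- by rewrite /= tensor_novikov_twist.
- by rewrite /= tensor_mul_twist.
Qed.
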